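(* Given a test graph $\mathcal G_k^{\mathrm{test}}$, let $\hat\theta=\arg\min_\theta\mathcal L$ be the GNN parameters minimizing the training objective $\mathcal L$. The impact of upweighting the objective $\mathcal L$ to $\mathcal L_{n,m}^{\mathrm{aug}}=\mathcal L+\epsilon_{n,m}\,\ell(\widetilde{\mathcal G}_n^m,\theta)$, where $\widetilde{\mathcal G}_n^m$ is an augmented graph candidate of the training graph $\mathcal G_n$ and $\epsilon_{n,m}$ is a sufficiently small perturbation parameter, on the model performance on the test graph is given by $$\frac{d\,\ell(\mathcal G_k^{\mathrm{test}},\hat\theta_{\epsilon_{n,m}})}{d\epsilon_{n,m}}\bigg|_{\epsilon_{n,m}=0}=-\nabla_\theta\ell(\mathcal G_k^{\mathrm{test}},\hat\theta)\,\mathbf H_{\hat\theta}^{-1}\,\nabla_\theta\ell(\widetilde{\mathcal G}_n^m,\hat\theta),$$ where $\hat\theta_{\epsilon_{n,m}}=\arg\min_\theta\mathcal L_{n,m}^{\mathrm{aug}}$ denotes the parameters minimizing the upweighted objective and $\mathbf H_{\hat\theta}=\nabla_\theta^2\mathcal L(\hat\theta)$ is the Hessian matrix of the loss with respect to the model parameters.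
   Context: $\ell(\mathcal G,\theta)$ denotes the loss $\ell(f(\mathcal G,\theta),y)$ of a model $f(\cdot,\theta)$ with parameter vector $\theta$ on the labelled graph $(\mathcal G,y)$, differentiable in $\theta$ as needed for the formula (the Hessian $\mathbf H_{\hat\theta}$ exists and is invertible). The training objective is $\mathcal L(\theta)=\frac1N\sum_{n=1}^N\ell(\mathcal G_n,\theta)$ over training graphs $\mathcal G_1,\dots,\mathcal G_N$. On the right-hand side the first gradient is read as a row vector and the last as a column vector.
   Formalization: Adds the assumption that the minimizers of the upweighted objective depend continuously on the perturbation parameter at 0 (with value θ̂ there); without it the minimizers can escape to infinity as the parameter tends to 0, and the formula fails. *)

(* Defs.v *)
From HB Require Import structures.
From mathcomp Require Import all_boot all_order all_algebra.
From mathcomp Require Import all_classical all_reals all_analysis.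

Set Implicit Arguments.
Unset Strict Implicit.
Unset Printing Implicit Defensive.

Import Order.TTheory GRing.Theory Num.Theory.
Import numFieldNormedType.Exports.

Local Open Scope classical_set_scope.
Local Open Scope ring_scope.

Definition is_argmin (R : realType) (T : Type) (F : T -> R) (x : T) : Prop :=
  forall y : T, F x <= F y.

Definition gradient (R : realType) (d : nat) (F : 'rV[R]_d -> R)
    (x : 'rV[R]_d) : 'rV[R]_d :=
  \row_(i < d) 'D_(delta_mx 0 i) F x.

(* With the row-vector convention of ['J], the (i, j) entry is the i-th partial
   derivative of the j-th partial derivative of F. *)
Definition hessian (R : realType) (d : nat) (F : 'rV[R]_d -> R)
    (x : 'rV[R]_d) : 'M[R]_d :=
  'J (gradient F) x.

(* ['D] and ['J] are total, so existence of the Hessian must be required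
   separately. *)
Definition twice_differentiable (R : realType) (d : nat) (F : 'rV[R]_d -> R)
    (x : 'rV[R]_d) : Prop :=
  (\forall y \near x, differentiable F y) /\ differentiable (gradient F) x.

(* A labelled graph is a pair [g] of a graph and its label; [f] is the model
   and [loss] compares its output with the label. *)
Definition graph_loss (R : realType) (d : nat) (graph output label : Type)
    (f : graph -> 'rV[R]_d -> output) (loss : output -> label -> R)
    (g : graph * label) (theta : 'rV[R]_d) : R :=
  loss (f g.1 theta) g.2.

Definition training_loss (R : realType) (d N : nat) (graph output label : Type)
    (f : graph -> 'rV[R]_d -> output) (loss : output -> label -> R)
    (Gtrain : 'I_N -> graph * label) (theta : 'rV[R]_d) : R :=
  N%:R^-1 * \sum_(n < N) graph_loss f loss (Gtrain n) theta.

Definition upweighted_loss (R : realType) (d N : nat)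
    (graph output label : Type)
    (f : graph -> 'rV[R]_d -> output) (loss : output -> label -> R)
    (Gtrain : 'I_N -> graph * label) (g : graph * label) (eps : R)
    (theta : 'rV[R]_d) : R :=
  training_loss f loss Gtrain theta + eps * graph_loss f loss g theta.

(* Main.v *)
(** At a minimiser [x] the Hessian [H] of the training loss [L] is symmetric
    and positive semidefinite, hence coercive since it is invertible.  Writing
    [g] for the gradient of the augmented loss [l] at [x], the Taylor expansion
    of [L + eps l] around [x] is, up to an additive constant, the quadratic
    [q (h - v) / 2] with [q h = h H h^T] and [v = - eps g H^-1].  Comparing the
    values at the minimiser [x + h] and at [x + v] gives
    [q (h - v) = o (|h|^2 + eps^2)], so [h = v + o (eps)] by coercivity.  The
    formula then follows from the chain rule. *)
Require Import Defs.
From HB Require Import structures.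
From mathcomp Require Import all_boot all_order all_algebra.
From mathcomp Require Import all_classical all_reals all_analysis.
From mathcomp Require Import ring lra.

Set Implicit Arguments.
Unset Strict Implicit.
Unset Printing Implicit Defensive.

Import Order.TTheory GRing.Theory Num.Theory.
Import numFieldNormedType.Exports.

Local Open Scope classical_set_scope.
Local Open Scope ring_scope.

(** * Inner product of row vectors and its comparison with the sup norm *)

Definition dot (R : realType) (d : nat) (u v : 'rV[R]_d) : R :=
  (u *m v^T) 0 0.

Section dot.
Variables (R : realType) (d : nat).
Implicit Types (u v w : 'rV[R]_d) (a : R) (H : 'M[R]_d).

Lemma dotE u v : dot u v = \sum_(i < d) u 0 i * v 0 i.
Proof. by rewrite /dot mxE; apply: eq_bigr => i _; rewrite mxE. Qed.

Lemma dotC u v : dot u v = dot v u.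
Proof. by rewrite !dotE; apply: eq_bigr => i _; rewrite mulrC. Qed.

Lemma dotDl u v w : dot (u + v) w = dot u w + dot v w.
Proof. by rewrite /dot mulmxDl mxE. Qed.

Lemma dotNl u v : dot (- u) v = - dot u v.
Proof. by rewrite /dot mulNmx mxE. Qed.

Lemma dotZl a u v : dot (a *: u) v = a * dot u v.
Proof. by rewrite /dot -scalemxAl mxE. Qed.

Lemma dotDr u v w : dot w (u + v) = dot w u + dot w v.
Proof. by rewrite dotC dotDl !(dotC w). Qed.

Lemma dotNr u v : dot v (- u) = - dot v u.
Proof. by rewrite dotC dotNl dotC. Qed.

Lemma dotZr a u v : dot v (a *: u) = a * dot v u.
Proof. by rewrite dotC dotZl dotC. Qed.

Lemma dot0l u : dot 0 u = 0.
Proof. by rewrite /dot mul0mx mxE. Qed.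

Lemma dot_mulmxl H u v : dot (u *m H) v = dot u (v *m H^T).
Proof. by rewrite /dot trmx_mul trmxK mulmxA. Qed.

Lemma norm_coord_le m n (A : 'M[R]_(m, n)) i j : `|A i j| <= `|A|.
Proof.
rewrite [`|A|]mx_normrE.
exact: (le_bigmax_cond _ (fun ij => `|A ij.1 ij.2|) (j := (i, j))).
Qed.

Lemma norm_rV_le u a : 0 <= a -> (forall i, `|u 0 i| <= a) -> `|u| <= a.
Proof.
move=> a0 ua; rewrite [`|u|]mx_normrE; apply/bigmax_leP; split=> //.
by move=> [i j] _ /=; rewrite ord1.
Qed.

(** Here [|u|] is the sup norm, so each of the [d] products is at most [|u| * |v|]; hence the factor
    [d]. *)
Lemma norm_dot_le u v : `|dot u v| <= d%:R * `|u| * `|v|.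
Proof.
rewrite dotE (le_trans (ler_norm_sum _ _ _))//.
rewrite -mulrA mulr_natl -[d in _ *+ d]card_ord -sumr_const ler_sum// => i _.
by rewrite normrM ler_pM// norm_coord_le.
Qed.

(** The square of each coordinate is one summand of the sum of squares. *)
Lemma sqr_norm_le_dot u : `|u| ^+ 2 <= dot u u.
Proof.
have dot_ge0 : 0 <= dot u u.
  by rewrite dotE sumr_ge0// => i _; rewrite -expr2 sqr_ge0.
rewrite -(sqr_sqrtr dot_ge0) lerXn2r ?nnegrE ?sqrtr_ge0//.
apply: norm_rV_le => [|i]; first exact: sqrtr_ge0.
rewrite -sqrtr_sqr ler_sqrt// dotE (bigD1 i)//= -expr2 lerDl sumr_ge0// => j _.
by rewrite -expr2 sqr_ge0.
Qed.

Lemma dot_eq0 u : (dot u u == 0) = (u == 0).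
Proof.
apply/idP/eqP => [/eqP u0|->]; last by rewrite dot0l.
have := sqr_norm_le_dot u; rewrite u0 => le0.
apply/eqP; rewrite -normr_eq0 -sqrf_eq0 eq_le le0 sqr_ge0//.
Qed.

Lemma mulmx_bounded H : exists2 c, 0 < c & forall u, `|u *m H| <= c * `|u|.
Proof.
(* The [+ 1] keeps the constant positive when [d] or [H] is zero. *)
exists (d%:R * `|H| + 1) => [|u]; first by rewrite ltr_wpDl// mulr_ge0.
have c0 : 0 <= d%:R * `|H| + 1 by rewrite addr_ge0// mulr_ge0.
apply: norm_rV_le => [|i]; first by rewrite mulr_ge0.
rewrite mxE (le_trans (ler_norm_sum _ _ _))// mulrDl mul1r.
apply: (@le_trans _ _ (d%:R * `|H| * `|u|)); last by rewrite lerDl.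
rewrite -mulrA mulr_natl -[d in _ *+ d]card_ord -sumr_const ler_sum// => j _.
by rewrite normrM mulrC ler_pM// norm_coord_le.
Qed.

End dot.

(** * Differentials, gradients and second-order expansion *)

Section derivatives.
Variables (R : realType) (d : nat).
Implicit Types (F : 'rV[R]_d -> R) (x p w : 'rV[R]_d).

Lemma differentiable_bound (V W : normedModType R) (f : V -> W) (x : V) :
  differentiable f x -> forall e : R, 0 < e -> exists2 r : R, 0 < r &
    forall h, `|h| < r -> `|f (x + h) - f x - 'd f x h| <= e * `|h|.
Proof.
move=> df e e0.
have /eqaddoP/(_ e e0)/nbhs_normP[r r0 fr] := diff_locally df.
exists r => // h hr.
have /fr : `|0 - h| < r by rewrite sub0r normrN.
by rewrite /= !fctE/= [h + x]addrC opprD addrA.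
Qed.

Lemma is_derive_diff_comp (V W : normedModType R) (g : R -> V) (f : V -> W)
    (t : R) (w : V) : is_derive t 1 g w -> differentiable f (g t) ->
  is_derive t 1 (f \o g) ('d f (g t) w).
Proof.
move=> [/derivable1_diffP dg <-] df.
have dfg : differentiable (f \o g) t by exact: differentiable_comp.
by apply: DeriveDef; [exact/derivable1_diffP|rewrite !deriveE// diff_comp].
Qed.

Lemma diff_gradient F x w : differentiable F x ->
  'd F x w = dot (gradient F x) w.
Proof.
move=> dF; rewrite {1}(row_sum_delta w) linear_sum dotE; apply: eq_bigr => i _.
by rewrite linearZ/= mxE deriveE// mulrC.
Qed.

Lemma diff_jacobian m (f : 'rV[R]_d -> 'rV[R]_m) x w :
  'd f x w = w *m 'J f x.
Proof. by rewrite /jacobian mul_rV_lin1. Qed.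

(* The mean value theorem applied to
   [t |-> F (x + p + t w) - t (dF x + p H) w - t^2 / 2 (w H) w]. *)
Lemma second_order_increment F x : twice_differentiable F x ->
  forall e : R, 0 < e -> exists2 r : R, 0 < r &
    forall p w, `|p| + `|w| < r ->
    `|F (x + p + w) - F (x + p) - dot (gradient F x) w
      - dot (p *m hessian F x) w - 2^-1 * dot (w *m hessian F x) w|
    <= e * (`|p| + `|w|) * `|w|.
Proof.
move=> [/nbhs_normP[r1 /= r1_gt0 Fdiff] Gdiff] e e0.
set H := hessian F x; set G := gradient F.
pose c : R := d%:R + 1.
have c0 : 0 < c by rewrite ltr_wpDl.
(* Dividing by [c = d + 1] absorbs the factor [d] of [norm_dot_le]. *)
have [r2 r2_gt0 Gr2] := differentiable_bound Gdiff (divr_gt0 e0 c0).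
exists (Num.min r1 r2) => [|p w]; first by rewrite lt_min r1_gt0.
rewrite lt_min => /andP[pw1 pw2].
pose phi (t : R) := F (x + p + t *: w) - t * dot (G x + p *m H) w
  - 2^-1 * t ^+ 2 * dot (w *m H) w.
pose dphi (t : R) := dot (G (x + p + t *: w)) w - dot (G x + p *m H) w
  - t * dot (w *m H) w.
have segment_le (t : R) : 0 <= t <= 1 -> `|p + t *: w| <= `|p| + `|w|.
  move=> /andP[t0 t1]; rewrite (le_trans (ler_normD _ _))// lerD2l normrZ.
  by rewrite ger0_norm// ler_piMl.
have phi_derive (t : R) : 0 <= t <= 1 -> is_derive t 1 phi (dphi t).
  move=> t01.
  have dF : differentiable F (x + p + t *: w).
    apply: Fdiff; rewrite /= -addrA opprD addrA subrr sub0r normrN.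
    exact: le_lt_trans (segment_le t t01) pw1.
  pose seg (s : R) := x + p + s *: w.
  have dseg : is_derive t 1 seg w.
    have dlin : is_derive t 1 ( *:%R^~ w) w.
      apply: DeriveDef; first exact/derivable1_diffP.
      by rewrite deriveE// diff_val scale1r.
    rewrite -[X in is_derive _ _ _ X]add0r.
    exact: is_deriveD (is_derive_cst (x + p) t 1) dlin.
  have := is_derive_diff_comp dseg dF.
  rewrite diff_gradient// => dFseg.
  have -> : phi = (F \o seg) - dot (G x + p *m H) w \*: id
      - (2^-1 * dot (w *m H) w) \*: (id ^+ 2).
    by apply/funext => s; rewrite /phi !fctE/= /GRing.scale/=; ring.
  apply: is_derive_eq.
  rewrite /dphi /seg /GRing.scale/= expr1.
  by field.
have [t t01 E] : exists2 t, t \in `[0, 1]%R & phi 1 - phi 0 = dphi t * (1 - 0).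
  apply: MVT_segment => // [t|].
    by rewrite in_itv/= => /andP[t0 t1]; apply: phi_derive; rewrite !ltW.
  apply: derivable_within_continuous => t; rewrite in_itv/= => t01.
  exact: (@ex_derive _ _ _ _ _ _ _ (phi_derive t t01)).
move: t01; rewrite in_itv/= => t01.
rewrite subr0 mulr1 in E.
have -> : F (x + p + w) - F (x + p) - dot (G x) w
  - dot (p *m H) w - 2^-1 * dot (w *m H) w = phi 1 - phi 0.
  by rewrite /phi scale1r scale0r addr0 dotDl; ring.
(* The derivative of [phi] is the first-order remainder of the gradient paired with [w], so
   differentiability of the gradient at [x] alone controls it. *)
have -> : phi 1 - phi 0 =
    dot (G (x + (p + t *: w)) - G x - 'd G x (p + t *: w)) w.
  rewrite E /dphi diff_jacobian mulmxDl -scalemxAl -/(hessian F x) -/H.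
  by rewrite !(dotDl, dotNl, dotZl) addrA; ring.
apply: (le_trans (norm_dot_le _ _)); rewrite ler_wpM2r//.
have := Gr2 _ (le_lt_trans (segment_le t t01) pw2) => Gle.
apply: (@le_trans _ _ (c * (e / c * `|p + t *: w|))).
  by rewrite ler_pM// /c lerDl.
rewrite mulrA (mulrC c) divfK ?gt_eqF// ler_wpM2l ?(ltW e0)//.
exact: segment_le.
Qed.

End derivatives.

(** * Small scalars and vanishing bounds *)

Lemma exists_small_scale (R : realFieldType) (r a : R) : 0 < r -> 0 <= a ->
  exists2 rho, 0 < rho & rho * a < r.
Proof.
move=> r0 a0; have a1 : 0 < a + 1 by rewrite ltr_wpDl.
exists (r / (a + 1)); first by rewrite divr_gt0.
by rewrite mulrAC ltr_pdivrMr// ltr_pM2l// ltrDl.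
Qed.

Lemma le0_of_small (R : realFieldType) (a K : R) : 0 <= K ->
  (forall e, 0 < e -> a <= e * K) -> a <= 0.
Proof.
move=> K0 aK; rewrite leNgt; apply/negP => a0.
have [rho rho0 rhoK] := exists_small_scale a0 K0.
by have := lt_le_trans rhoK (aK _ rho0); rewrite ltxx.
Qed.

(** * Symmetry of the Hessian and conditions at a minimiser *)

Section second_order_conditions.
Variables (R : realType) (d : nat).
Implicit Types (F : 'rV[R]_d -> R) (x s t h : 'rV[R]_d) (H : 'M[R]_d).

(* Both sides approximate the second difference
   [F (x + s + t) - F (x + s) - F (x + t) + F x], which is symmetric. *)
Lemma dot_hessianC F x s t : twice_differentiable F x ->
  dot (s *m hessian F x) t = dot (t *m hessian F x) s.
Proof.
move=> dF; set H := hessian F x.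
apply/eqP; rewrite -subr_eq0 -normr_le0.
(* [K] collects the errors of the expansions at [(s, t)], [(0, t)], [(t, s)] and [(0, s)]. After
   scaling by [rho], errors and bilinear terms all carry [rho ^+ 2], which cancels. *)
pose K : R := (`|s| + `|t|) * `|t| + (0 + `|t|) * `|t|
  + ((`|t| + `|s|) * `|s| + (0 + `|s|) * `|s|).
apply: (@le0_of_small _ _ K) => [|e e0].
  by rewrite !addr_ge0// mulr_ge0// addr_ge0.
have [r r0 Fr] := second_order_increment dF e0.
have [rho rho0 rhor] : exists2 rho, 0 < rho & rho * (`|s| + `|t|) < r.
  by apply: exists_small_scale => //; rewrite addr_ge0.
have normZ u : `|rho *: u| = rho * `|u| by rewrite normrZ gtr0_norm.
have st : `|rho *: s| + `|rho *: t| < r by rewrite !normZ -mulrDr.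
have ts : `|rho *: t| + `|rho *: s| < r by rewrite addrC.
have t0 : `|0 : 'rV[R]_d| + `|rho *: t| < r.
  by rewrite normr0 add0r (le_lt_trans _ st)// lerDr.
have s0 : `|0 : 'rV[R]_d| + `|rho *: s| < r.
  by rewrite normr0 add0r (le_lt_trans _ st)// lerDl.
have := Fr _ _ st; have := Fr _ _ ts; have := Fr _ _ s0; have := Fr _ _ t0.
rewrite (addrAC x (rho *: t)) addr0 mul0mx !dot0l -!scalemxAl -/H.
rewrite !(dotZl, dotZr) !normZ normr0 !ler_norml.
move=> /andP[? ?] /andP[? ?] /andP[? ?] /andP[? ?].
have rho2 : 0 < rho ^+ 2 by rewrite exprn_gt0.
by apply/andP; split; rewrite -(ler_pM2l rho2) /K; lra.
Qed.

Lemma hessian_sym F x : twice_differentiable F x ->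
  (hessian F x)^T = hessian F x.
Proof.
move=> dF; apply/matrixP => i j; rewrite mxE.
have dot_delta (A : 'M[R]_d) a b :
    dot (delta_mx 0 a *m A) (delta_mx 0 b) = A a b.
  by rewrite /dot -rowE trmx_delta -colE !mxE.
by rewrite -(dot_delta _ j i) dot_hessianC// dot_delta.
Qed.

Lemma gradient_argmin F x : is_argmin F x -> differentiable F x ->
  gradient F x = 0.
Proof.
move=> Fmin dF.
have dF_ge0 h : 0 <= dot (gradient F x) h.
  rewrite -oppr_le0; apply: (@le0_of_small _ _ `|h|) => // e e0.
  have [r r0 Fr] := differentiable_bound dF e0.
  have [rho rho0 rhor] := exists_small_scale r0 (normr_ge0 h).
  have normZ : `|rho *: h| = rho * `|h| by rewrite normrZ gtr0_norm.
  have := Fr (rho *: h); rewrite normZ diff_gradient// dotZr => /(_ rhor).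
  rewrite ler_norml => /andP[_].
  have := Fmin (x + rho *: h) => minh le_e.
  rewrite -(ler_pM2l rho0); nra.
(* The choice [h = - gradient F x] forces the squared length to be nonpositive. *)
apply/eqP; rewrite -dot_eq0 eq_le dF_ge0 andbT -oppr_ge0 -dotNr.
exact: dF_ge0.
Qed.

(** The gradient vanishes, so the increment of [F] along [rho *: h] is half the Hessian form, scaled
    by [rho ^+ 2], up to a smaller error. *)
Lemma hessian_argmin_ge0 F x h : is_argmin F x -> twice_differentiable F x ->
  0 <= dot (h *m hessian F x) h.
Proof.
move=> Fmin d2F; have [/nbhs_singleton dF _] := d2F.
rewrite -oppr_le0.
apply: (@le0_of_small _ _ (2 * `|h| ^+ 2)) => [|e e0].
  by rewrite mulr_ge0.
have [r r0 Fr] := second_order_increment d2F e0.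
have [rho rho0 rhor] := exists_small_scale r0 (normr_ge0 h).
have normZ : `|rho *: h| = rho * `|h| by rewrite normrZ gtr0_norm.
have := Fr 0 (rho *: h); rewrite normr0 add0r normZ => /(_ rhor).
rewrite gradient_argmin// mul0mx !dot0l addr0 !subr0 -scalemxAl.
rewrite dotZl dotZr ler_norml => /andP[_].
have := Fmin (x + rho *: h) => minh le_e.
rewrite -(ler_pM2l (exprn_gt0 2 rho0)); nra.
Qed.

(* With [w = h H], minimising [q (h - t w)] over [t] in [0 <= q (h - t w)]
   bounds [|w|^2] by a multiple of [q h], and [h = w H^-1]. *)
Lemma coercive_of_psd H : H^T = H -> H \in unitmx ->
  (forall h, 0 <= dot (h *m H) h) ->
  exists2 c, 0 < c & forall h, c * `|h| ^+ 2 <= dot (h *m H) h.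
Proof.
move=> Hsym Hunit Hpsd.
have [C C0 HC] := mulmx_bounded H.
have [C' C'0 HC'] := mulmx_bounded (invmx H).
pose b : R := d%:R * C + 1.
have b0 : 0 < b by rewrite ltr_wpDl// mulr_ge0// ltW.
have C'b0 : 0 < C' ^+ 2 * b by rewrite mulr_gt0// exprn_gt0.
exists (C' ^+ 2 * b)^-1 => [|h]; first by rewrite invr_gt0.
rewrite mulrC ler_pdivrMr// mulrC.
set w := h *m H.
have wb : dot (w *m H) w <= b * dot w w.
  apply: le_trans (ler_norm _) _; apply: le_trans (norm_dot_le _ _) _.
  apply: (@le_trans _ _ (b * `|w| ^+ 2)).
    rewrite expr2 mulrA ler_wpM2r// mulrDl mul1r -mulrA.
    by rewrite (@le_trans _ _ (d%:R * (C * `|w|)))// ?ler_wpM2l// mulrA lerDl.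
  by rewrite ler_wpM2l ?(ltW b0)// sqr_norm_le_dot.
(* Take [t = b^-1]: the cross terms give [- 2 b^-1 |w|^2] (Euclidean), and by [wb] the last term
   gives back at most [b^-1 |w|^2]. *)
have ww : dot w w <= b * dot w h.
  have := Hpsd (h - b^-1 *: w).
  rewrite mulmxBl -scalemxAl -/w dotDl !dotDr !dotNl !dotNr !dotZl !dotZr.
  rewrite (dot_mulmxl H w h) Hsym -/w => ge0.
  have bV0 : 0 < b^-1 by rewrite invr_gt0.
  have := ler_wpM2l (ltW (exprn_gt0 2 bV0)) wb.
  have -> : b^-1 ^+ 2 * (b * dot w w) = b^-1 * dot w w.
    by field; rewrite gt_eqF.
  move=> le_b.
  by rewrite -ler_pdivrMl//; lra.
have hw : `|h| ^+ 2 <= C' ^+ 2 * dot w w.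
  rewrite (@le_trans _ _ ((C' * `|w|) ^+ 2))//.
    rewrite lerXn2r ?nnegrE ?mulr_ge0 ?(ltW C'0)//.
    by have := HC' w; rewrite /w mulmxK.
  by rewrite exprMn ler_wpM2l ?sqr_ge0// sqr_norm_le_dot.
by rewrite (le_trans hw)// -(mulrA _ b) ler_wpM2l ?sqr_ge0.
Qed.

End second_order_conditions.

(** * First-order dependence of the minimiser on the perturbation *)

Lemma is_derive_of_bound (R : realType) (V : normedModType R) (u : R -> V)
    (v : V) :
  (forall e, 0 < e -> \forall t \near (0 : R),
     `|u t - u 0 - t *: v| <= e * `|t|) ->
  is_derive (0 : R) 1 u v.
Proof.
move=> uv.
have lim_uv : (fun t : R => t^-1 *: ((u \o shift 0) (t *: 1) - u 0)) t
    @[t --> 0^'] --> v.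
  apply/cvgrPdist_le => e e0.
  rewrite near_withinE; apply: filterS (uv e e0) => t le_e t0.
  have -> : v = t^-1 *: (t *: v) by rewrite scalerA mulVf// scale1r.
  rewrite -scalerBr normrZ.
  rewrite normfV ler_pdivrMl ?normr_gt0// mulrC distrC /= addr0.
  by rewrite [_%:A]mulr1.
by apply: DeriveDef; [apply/cvg_ex; exists v|exact: cvg_lim].
Qed.

Section perturbed_argmin.
Variables (R : realType) (d : nat) (L l : 'rV[R]_d -> R) (x : 'rV[R]_d).
Hypotheses (L_min : is_argmin L x) (L_diff2 : twice_differentiable L x).
Hypothesis hessian_unit : hessian L x \in unitmx.
Hypothesis l_diff : differentiable l x.

Let H := hessian L x.
Let g := gradient l x.
Let v0 := - (g *m invmx H).

(* [l] need not be differentiable at the perturbed minimiser [x + h], so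
   there is no first-order condition there; instead its objective value is
   compared with the one at the candidate [x + eps v0]. *)
Lemma perturbed_argmin_bound (e : R) : 0 < e -> exists2 r : R, 0 < r &
  forall (eps : R) h, `|eps| < r -> `|h| < r ->
    is_argmin (fun y => L y + eps * l y) (x + h) ->
    `|h - eps *: v0| <= e * `|eps|.
Proof.
move=> e0.
have Hsym : H^T = H := hessian_sym L_diff2.
have [c c0 Hc] := coercive_of_psd Hsym hessian_unit
  (fun h => hessian_argmin_ge0 h L_min L_diff2).
have [/nbhs_singleton L_diff _] := L_diff2.
pose b := `|v0|.
have b0 : 0 <= b by exact: normr_ge0.
pose K := 3 * b ^+ 2 + 2 * b + 1.
have K0 : 0 < K by rewrite ltr_wpDl// addr_ge0// mulr_ge0// sqr_ge0.
(* The first bound lets [3 * eta * a ^+ 2] be absorbed by half of [c / 2 * a ^+ 2]; the second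
   leaves [c / 4 * (e * t) ^+ 2] for the term in [K]. *)
pose eta := Num.min (c / 12) (c * e ^+ 2 / (4 * K)).
have eta0 : 0 < eta by rewrite lt_min !divr_gt0 ?mulr_gt0 ?exprn_gt0.
have eta_c : 12 * eta <= c.
  by rewrite mulrC -ler_pdivlMr// /eta ge_min lexx.
have eta_K : 4 * K * eta <= c * e ^+ 2.
  by rewrite mulrC -ler_pdivlMr ?mulr_gt0// /eta ge_min lexx orbT.
have [r1 r1_gt0 Lr] := second_order_increment L_diff2 eta0.
have [r2 r2_gt0 lr] := differentiable_bound l_diff eta0.
have [r3 r3_gt0 r3b] : exists2 r3, 0 < r3 & r3 * b < Num.min r1 r2.
  by apply: exists_small_scale; rewrite // lt_min r1_gt0.
exists (Num.min r3 (Num.min r1 r2)) => [|eps h].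
  by rewrite !lt_min r1_gt0 r2_gt0 r3_gt0.
rewrite !lt_min => /and3P[eps3 _ _] /and3P[_ h1 h2] /(_ (x + eps *: v0)) min_h.
pose v := eps *: v0.
have norm_v : `|v| = `|eps| * b by rewrite normrZ.
have v_small : `|v| < Num.min r1 r2.
  by rewrite (le_lt_trans _ r3b)// norm_v ler_wpM2r// ltW.
move: v_small; rewrite lt_min => /andP[v1 v2].
(* The choice of [v0] turns the linear term of [eps * l] into a cross term of the quadratic form,
   which completes the square. *)
have vH : v *m H = - (eps *: g).
  by rewrite /v /v0 -scalemxAl mulNmx mulmxKV// scalerN.
have eps_g w : eps * dot g w = - dot (v *m H) w.
  by rewrite vH dotNl dotZl opprK.
have L_expand w : `|w| < r1 ->
    `|L (x + w) - L x - 2^-1 * dot (w *m H) w| <= eta * `|w| ^+ 2.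
  move=> w1; have := Lr 0 w; rewrite normr0 add0r => /(_ w1).
  rewrite gradient_argmin// mul0mx !dot0l addr0 !subr0.
  by rewrite expr2 mulrA.
have l_expand w : `|w| < r2 ->
    `|eps * (l (x + w) - l x) + dot (v *m H) w| <= `|eps| * (eta * `|w|).
  move=> /lr; rewrite diff_gradient// -/g => lw.
  rewrite -[dot _ w]opprK -eps_g -mulrBr normrM.
  by rewrite ler_wpM2l.
have square : dot ((h - v) *m H) (h - v) =
    dot (h *m H) h - 2 * dot (v *m H) h + dot (v *m H) v.
  rewrite mulmxBl !(dotDl, dotDr, dotNl, dotNr) (dot_mulmxl H h v) Hsym.
  by rewrite (dotC h); ring.
have h_le : `|h| <= `|h - v| + `|eps| * b.
  by rewrite -norm_v -{1}(subrK v h) ler_normD.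
have := Hc (h - v); rewrite square -/v.
have := L_expand h h1; have := L_expand v v1.
have := l_expand h h2; have := l_expand v v2.
rewrite norm_v !ler_norml => /andP[_ lv] /andP[lh _] /andP[_ Lv] /andP[Lh _].
move: min_h h_le lv lh Lv Lh; rewrite -/v.
move: (dot (h *m H) h) (dot (v *m H) h) (dot (v *m H) v) => Qh Qvh Qv.
move: (L (x + h)) (L (x + v)) (L x) (l (x + h)) (l (x + v)) (l x).
move=> Lh Lv Lx lh lv lx.
have := normr_ge0 h; have := normr_ge0 (h - v); have := normr_ge0 eps.
move: `|h| `|h - v| => nh a; set t := `|eps|.
move=> t0 a0 nh0 min_h h_le lv_le lh_le Lv_le Lh_le coerc.
(* Sum of the four expansions, [min_h] and coercivity at [h - v]; the values of [L] and [l]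
   cancel. *)
have upper : c / 2 * a ^+ 2 <=
    eta * (nh ^+ 2 + t * nh + (t * b) ^+ 2 + t * (t * b)).
  lra.
have nh2 : nh ^+ 2 + t * nh <= (a + t * b) ^+ 2 + t * (a + t * b).
  by rewrite lerD// ?ler_wpM2l// lerXn2r ?nnegrE// addr_ge0 ?mulr_ge0.
(* The cross products of [a], [t] and [t * b] are split by [2xy <= x^2 + y^2]; this dictates [K]. *)
have quad : (a + t * b) ^+ 2 + t * (a + t * b) + (t * b) ^+ 2 + t * (t * b) <=
    3 * a ^+ 2 + K * t ^+ 2.
  rewrite /K.
  have := sqr_ge0 (a - t * b); have := sqr_ge0 (a - t); have := sqr_ge0 t.
  have := sqr_ge0 a.
  lra.
have total : c / 2 * a ^+ 2 <= eta * (3 * a ^+ 2 + K * t ^+ 2).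
  by rewrite (le_trans upper)// ler_wpM2l ?(ltW eta0)//; lra.
have at2 : c * a ^+ 2 <= c * (e * t) ^+ 2.
  have := ler_wpM2r (sqr_ge0 a) eta_c.
  have := ler_wpM2r (sqr_ge0 t) eta_K.
  lra.
have et0 : 0 <= e * t by rewrite mulr_ge0// ltW.
by move: at2; rewrite ler_pM2l// ler_sqr.
Qed.

(** Continuity at [0] brings [u eps] within the radius where [perturbed_argmin_bound] applies; that
    bound says nothing about minimisers far from [x]. *)
Lemma is_derive_perturbed_argmin (u : R -> 'rV[R]_d) :
  (\forall eps \near (0 : R), is_argmin (fun y => L y + eps * l y) (u eps)) ->
  u 0 = x -> {for (0 : R), continuous u} -> is_derive (0 : R) 1 u v0.
Proof.
move=> u_min u0 u_cont; apply: is_derive_of_bound => e e0.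
have [r r0 bound] := perturbed_argmin_bound e0.
have u_near : \forall eps \near (0 : R), `|u eps - x| < r.
  have /cvgrPdist_lt/(_ r r0) : u eps @[eps --> (0 : R)] --> x by rewrite -u0.
  by apply: filterS => t; rewrite distrC.
have eps_near : \forall eps \near (0 : R), `|eps| < r.
  by apply/nbhs_normP; exists r => // t; rewrite /= sub0r normrN.
near=> t.
rewrite u0; apply: bound; [by near: t|by near: t|].
by rewrite addrC subrK; near: t.
Unshelve. all: by end_near. Qed.

End perturbed_argmin.

(** * Chain rule for the test loss along the perturbed minimisers *)

Theorem theorem7p3p4 (R : realType) (d N M K : nat)
    (graph output label : Type)
    (f : graph -> 'rV[R]_d -> output) (loss : output -> label -> R)
    (Gtrain : 'I_N -> graph * label)
    (Gaug : 'I_N -> 'I_M -> graph * label)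
    (Gtest : 'I_K -> graph * label)
    (n : 'I_N) (m : 'I_M) (k : 'I_K)
    (theta_hat : 'rV[R]_d) (theta_eps : R -> 'rV[R]_d)
    (theta_hat_argmin : is_argmin (training_loss f loss Gtrain) theta_hat)
    (theta_eps_argmin : \forall eps \near (0 : R),
       is_argmin (upweighted_loss f loss Gtrain (Gaug n m) eps)
         (theta_eps eps))
    (theta_eps0 : theta_eps 0 = theta_hat)
    (theta_eps_continuous : {for (0 : R), continuous theta_eps})
    (training_diff2 :
       twice_differentiable (training_loss f loss Gtrain) theta_hat)
    (hessian_unit :
       hessian (training_loss f loss Gtrain) theta_hat \in unitmx)
    (aug_diff : differentiable (graph_loss f loss (Gaug n m)) theta_hat)
    (test_diff : differentiable (graph_loss f loss (Gtest k)) theta_hat) :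
  is_derive (0 : R) 1
    (fun eps : R => graph_loss f loss (Gtest k) (theta_eps eps))
    (- (gradient (graph_loss f loss (Gtest k)) theta_hat
        *m invmx (hessian (training_loss f loss Gtrain) theta_hat)
        *m (gradient (graph_loss f loss (Gaug n m)) theta_hat)^T) 0 0).
Proof.
have u_derive := is_derive_perturbed_argmin theta_hat_argmin training_diff2
  hessian_unit aug_diff theta_eps_argmin theta_eps0 theta_eps_continuous.
have test_diff' : differentiable (graph_loss f loss (Gtest k)) (theta_eps 0).
  by rewrite theta_eps0.
apply: is_derive_eq (is_derive_diff_comp u_derive test_diff') _.
rewrite theta_eps0 diff_gradient// dotNr; congr (- _).
(* Transposing the derivative of [theta_eps] yields the transposed inverse Hessian, which symmetry
   identifies with the inverse itself. *)
have Hsym := hessian_sym training_diff2.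
by rewrite /dot trmx_mul trmx_inv Hsym mulmxA.
Qed.
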